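(* Let $G$ be a connected $\Delta$-regular graph with $n$ vertices and diameter $D$, and let $H$ be a proper subgraph of $G$. Then $$2\Delta - \mu(H) > \frac{1}{n\left(D-\frac{1}{4}\right)}.$$
   Context: All graphs are finite, undirected and simple. For a graph $H$, let $A(H)$ be its adjacency matrix and $D(H)$ the diagonal matrix of its vertex degrees. The Laplacian matrix of $H$ is $L(H)=D(H)-A(H)$, and $\mu(H)$ denotes the largest eigenvalue of $L(H)$ (the Laplacian spectral radius). The diameter of $G$ is the maximum distance between two vertices of $G$. A proper subgraph of $G$ is a subgraph (with at least one vertex) different from $G$. *)

(* Defs.v *)
From HB Require Import structures.
From mathcomp Require Import all_boot all_order all_algebra.
From mathcomp Require Import boolp classical_sets reals.

Set Implicit Arguments.
Unset Strict Implicit.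
Unset Printing Implicit Defensive.

Import Order.TTheory GRing.Theory Num.Theory.

Local Open Scope ring_scope.

Record sgraph := SGraph {
  vertex :> finType;
  edge : rel vertex;
  edge_sym : symmetric edge;
  edge_irrefl : irreflexive edge
}.

Section Graph.
Variable G : sgraph.

Definition degree (x : G) : nat := #|[set y : G | edge x y]|.

Definition regular (k : nat) : Prop := forall x : G, degree x = k.

Definition connected : Prop := forall x y : G, connect (@edge G) x y.

Definition walk_of_length (x y : G) (k : nat) : bool :=
  [exists p : k.-tuple G, path (@edge G) x p && (last x p == y)].

(* The least length of a walk from x to y; a shortest walk visits no vertex
   twice, so it has fewer than #|G| edges and the search range suffices.  The
   value is #|G| when y is not reachable from x. *)
Definition distance (x y : G) : nat :=
  find (walk_of_length x y) (iota 0 #|G|).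

Definition diameter : nat := (\max_(x : G) \max_(y : G) distance x y)%N.

Lemma distance_le (x : G) (p : seq G) :
  path (@edge G) x p -> (distance x (last x p) <= size p)%N.
Proof.
move=> xp; have [ltpG|leGp] := ltnP (size p) #|G|; last first.
  apply: leq_trans leGp.
  by rewrite -[X in (_ <= X)%N](size_iota 0 #|G|) find_size.
rewrite leqNgt; apply/negP => /(before_find 0%N).
rewrite nth_iota // add0n => /negbT/existsP; apply.
by exists (in_tuple p); rewrite xp eqxx.
Qed.

Lemma distance_walk (x y : G) :
  connect (@edge G) x y -> walk_of_length x y (distance x y).
Proof.
case/connectP => p0 /shortenP [p xp up _] ->.
have ltpG : (size p < #|G|)%N.
  by have := max_card (mem (x :: p)); rewrite (card_uniqP up).
have hs : has (walk_of_length x (last x p)) (iota 0 #|G|).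
  apply/hasP; exists (size p); first by rewrite mem_iota.
  by apply/existsP; exists (in_tuple p); rewrite xp eqxx.
have := nth_find 0%N hs; rewrite nth_iota ?add0n //.
by move: hs; rewrite has_find size_iota.
Qed.

Variable R : realType.

Definition adjacency_mx : 'M[R]_#|G| :=
  \matrix_(i, j) (edge (enum_val i) (enum_val j))%:R.

Definition degree_mx : 'M[R]_#|G| :=
  diag_mx (\row_i (degree (enum_val i))%:R).

Definition laplacian : 'M[R]_#|G| := degree_mx - adjacency_mx.

(* The set of eigenvalues is finite, and nonempty as soon as G is, so that this
   supremum is a maximum: see laplacian_radius_eigenvalue and
   laplacian_radius_ge.  All the eigenvalues are real, as L(G) is symmetric. *)
Definition laplacian_radius : R :=
  sup [set a : R | eigenvalue laplacian a]%classic.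

Lemma eigenvalue_laplacian0 : (0 < #|G|)%N -> eigenvalue laplacian 0.
Proof.
move=> G0; apply/eigenvalueP; exists (const_mx 1); last first.
  apply/eqP => /rowP /(_ (Ordinal G0)); rewrite !mxE.
  by apply/eqP; rewrite oner_eq0.
rewrite scale0r; apply/rowP => j; rewrite !mxE.
under eq_bigr => i _ do rewrite !mxE mul1r.
rewrite sumrB; apply/eqP; rewrite subr_eq0; apply/eqP.
rewrite (bigD1 j) //= eqxx mulr1n big1 ?addr0; last first.
  by move=> i /negPf ->; rewrite mulr0n.
rewrite -natr_sum; congr (_%:R).
rewrite -(big_enum_val (fun x => nat_of_bool (edge x (enum_val j)))) /=.
rewrite -big_mkcond sum1_card /degree cardsE.
by apply: eq_card => x; apply: edge_sym.
Qed.

Lemma exists_max_eigenvalue : (0 < #|G|)%N ->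
  exists2 m, eigenvalue laplacian m & forall a, eigenvalue laplacian a -> a <= m.
Proof.
move=> G0; apply: contrapT => nomax.
have next a : eigenvalue laplacian a -> exists2 b, eigenvalue laplacian b & a < b.
  move=> La; apply: contrapT => noupper; apply: nomax; exists a => // b Lb.
  by rewrite leNgt; apply/negP => ab; apply: noupper; exists b.
have chain k : exists (a : R) (s : seq R), [/\ size s = k,
    path (fun x y => y < x) a s & all (eigenvalue laplacian) (a :: s)].
  elim: k => [|k [a [s [<- as_ /=/andP[La Ls]]]]].
    by exists 0, [::]; rewrite /= eigenvalue_laplacian0.
  have [b Lb ab] := next _ La; exists b, (a :: s).
  by split; rewrite //= ?ab ?Lb ?La.
have [a [s [sk as_ Ls]]] := chain #|G|.
have p0 : char_poly laplacian != 0 by rewrite monic_neq0 ?char_poly_monic.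
have := max_poly_roots p0 (rs := a :: s); rewrite size_char_poly /= sk ltnn.
have us : uniq (a :: s).
  apply: (@sorted_uniq _ (fun x y : R => y < x)) => // y x z xy yz.
  exact: lt_trans yz xy.
have rs : all (root (char_poly laplacian)) (a :: s).
  by apply: sub_all Ls => x; rewrite eigenvalue_root_char.
by move=> /(_ rs us).
Qed.

Lemma laplacian_radius_ge (a : R) :
  eigenvalue laplacian a -> a <= laplacian_radius.
Proof.
have [G0|] := posnP #|G|.
  case/eigenvalueP => v _ /eqP[]; apply/rowP => i.
  by have := ltn_ord i; rewrite {2}G0.
move=> /exists_max_eigenvalue[m _ mP] La.
by apply: (@ub_le_sup R) => //; exists m => b /mP.
Qed.

Lemma laplacian_radius_eigenvalue :
  (0 < #|G|)%N -> eigenvalue laplacian laplacian_radius.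
Proof.
move=> /exists_max_eigenvalue[m Lm mP].
suff -> : laplacian_radius = m by [].
apply/eqP; rewrite eq_le laplacian_radius_ge // andbT.
by apply: ge_sup; [exists m|move=> b /mP].
Qed.
End Graph.

Record subgraph (G : sgraph) := SubGraph {
  sub_vertex : {set G};
  sub_edge : rel G;
  sub_edge_sym : symmetric sub_edge;
  sub_edge_vertex : forall x y, sub_edge x y -> x \in sub_vertex;
  sub_edge_edge : forall x y, sub_edge x y -> edge x y
}.

Section SubGraph.
Variables (G : sgraph) (H : subgraph G).

Definition proper_subgraph : Prop :=
  (0 < #|sub_vertex H|)%N /\
  ~ (sub_vertex H = [set: G] /\ sub_edge H =2 @edge G).

Let V := {x : G | x \in sub_vertex H}.

Let e : rel V := fun x y => sub_edge H (val x) (val y).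

Fact sub_sgraph_sym : symmetric e.
Proof. by move=> x y; apply: sub_edge_sym. Qed.

Fact sub_sgraph_irrefl : irreflexive e.
Proof.
by move=> x; apply/negP => /sub_edge_edge; rewrite edge_irrefl.
Qed.

Definition sgraph_of_subgraph : sgraph :=
  SGraph sub_sgraph_sym sub_sgraph_irrefl.
End SubGraph.

Coercion sgraph_of_subgraph : subgraph >-> sgraph.

(* Main.v *)
Require Import Defs.
From mathcomp Require Import all_boot all_order all_algebra.
From mathcomp Require Import reals.
From mathcomp Require Import ring lra.

Set Implicit Arguments.
Unset Strict Implicit.
Unset Printing Implicit Defensive.

Import Order.TTheory GRing.Theory Num.Theory.
Local Open Scope ring_scope.

(** Let mu be the Laplacian spectral radius of H, let g be an eigenvector of
    L(H) for mu, extended by 0 to the vertices of G outside H, and let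
    f = |g|.  The Rayleigh quotient gives
      mu * sum_x g(x)^2 = sum_{xy in E(H)} (g(x) - g(y))^2,
    regularity gives
      2 Delta * sum_x g(x)^2 = sum_{xy in E(G)} 2 (g(x)^2 + g(y)^2),
    and 2 (s^2 + t^2) = (s - t)^2 + (s + t)^2.  Since
    (g(x) - g(y))^2 <= (f(x) + f(y))^2, the terms (f(x) + f(y))^2 of the edges
    of H pay for mu.  G is connected and H is proper, so some edge ab of G is
    not in H (proper_subgraph_missing_edge), and what is left is at least
      T = sum_{xy in E(G)} (f(x) - f(y))^2 + (f(a) + f(b))^2,
    that is, (2 Delta - mu) * sum_x f(x)^2 >= T (grounded_energy_le).

    As (s - t)^2 + (s + t)^2 = 2 s^2 + 2 t^2 for s = f(a) and t = f(b), the
    number T is the energy of the potential f in an electrical network: the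
    edges of G other than ab are unit resistors, and a and b are each tied to
    the ground through a resistor 1/2.  The core of the proof is that every
    vertex u has effective resistance at most D - 1/4 to the ground, so that
    f(u)^2 <= (D - 1/4) T (sqr_le_grounded_energy).
    - If a is nearer to u than b, then a is at distance k <= D - 1 of u.  A
      shortest path to a followed by the resistor 1/2 has resistance
      k + 1/2 <= D - 1/2.
    - If a and b are both at distance k <= D, take a shortest path to each of
      them.  The two paths may share edges, but their last edges are distinct,
      because they have distinct ends.  At worst the paths agree up to distance
      k - 1, with resistance k - 1 so far; afterwards two branches of
      resistance 1 + 1/2 lie in parallel, which adds 3/4 only, for a total of
      k - 1/4.

    Summing over u gives sum_u f(u)^2 <= n (D - 1/4) T.  This is strict
    because T >= 2 f(a)^2 while D - 1/4 >= 3/4, so the bound on f(a)^2 is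
    strict (sum_sqr_lt_grounded_energy). *)

(** * Sums and squares *)

Lemma ler_sum_disjoint (R : numDomainType) (I : finType) (P Q : pred I)
    (s : seq I) (F : I -> R) :
    (forall i, 0 <= F i) -> uniq s -> subpred P Q ->
    all [predD Q & P] s ->
  \sum_(i | P i) F i + \sum_(i <- s) F i <= \sum_(i | Q i) F i.
Proof.
move=> F_ge0 s_uniq PQ /allP sQP.
rewrite [leRHS](bigID P) /=.
have -> : \sum_(i | Q i && P i) F i = \sum_(i | P i) F i.
  by apply: eq_bigl => i; rewrite andbC; case: (boolP (P i)) => // /PQ ->.
rewrite lerD2l big_uniq //= [leRHS](bigID (mem s)) /=.
rewrite [X in _ <= X + _](_ : _ = \sum_(i in s) F i).
  by rewrite lerDl sumr_ge0.
apply: eq_bigl => i; case: (boolP (i \in s)) => [/sQP/= /andP[iP iQ]|_].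
  by rewrite [Q i]iQ [P i](negPf iP).
by rewrite andbF.
Qed.

Lemma sqrBC (R : comPzRingType) (x y : R) : (x - y) ^+ 2 = (y - x) ^+ 2.
Proof. by rewrite -sqrrN opprB. Qed.

Lemma exchange_sum_rel (R : nmodType) (T : finType) (e : rel T)
    (F : T -> T -> R) :
  \sum_x \sum_(y | e x y) F x y = \sum_y \sum_(x | e x y) F x y.
Proof.
under eq_bigr do rewrite big_mkcond.
by rewrite exchange_big; apply: eq_bigr => y _; rewrite [RHS]big_mkcond.
Qed.

(** The factor 2 comes from the two orientations of the edge ab. *)
Lemma sum_rel_ge (R : realFieldType) (T : finType) (e : rel T)
    (F : T -> T -> R) (a b : T) :
    symmetric e -> (forall x y, F x y = F y x) -> (forall x y, 0 <= F x y) ->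
    a != b -> e a b ->
  2 * F a b <= \sum_x \sum_(y | e x y) F x y.
Proof.
move=> e_sym F_sym F_ge0 ab eab.
have row_ge0 x : 0 <= \sum_(y | e x y) F x y by apply: sumr_ge0.
have row_ge x y : e x y -> F x y <= \sum_(y | e x y) F x y.
  by move=> exy; rewrite (bigD1 y) //= lerDl sumr_ge0.
rewrite (bigD1 a) // (bigD1 b) 1?eq_sym //= mulr_natl mulr2n.
rewrite lerD ?row_ge // -[leLHS]addr0 lerD ?sumr_ge0 // F_sym row_ge //.
by rewrite e_sym.
Qed.

(** Green's identity on a finite graph, each edge being summed in both
    orientations. *)
Lemma sum_rel_green (R : comPzRingType) (T : finType) (e : rel T)
    (g : T -> R) : symmetric e ->
  2 * \sum_y \sum_(x | e x y) g y * (g y - g x) =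
    \sum_x \sum_(y | e x y) (g x - g y) ^+ 2.
Proof.
move=> e_sym; rewrite mulr_natl mulr2n -{1}exchange_sum_rel -big_split.
apply: eq_bigr => x _ /=.
under [X in _ + X]eq_bigl do rewrite e_sym.
by rewrite -big_split; apply: eq_bigr => y _ /=; ring.
Qed.

(** Resistances in series add up: c and d are the resistances, A and B the
    energies dissipated in them, x and y the voltages across them. *)
Lemma sqrD_le_mulD (R : realFieldType) (x y c d A B : R) :
    0 <= c -> 0 <= d -> 0 <= A -> 0 <= B ->
    x ^+ 2 <= c * A -> y ^+ 2 <= d * B ->
  (x + y) ^+ 2 <= (c + d) * (A + B).
Proof.
move=> c0 d0 A0 B0 xA yB.
suff xy : 2 * (x * y) <= c * B + d * A by nra.
have cross_ge0 : 0 <= c * B + d * A by rewrite addr_ge0 ?mulr_ge0.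
apply: le_trans (ler_norm _) _.
rewrite -(@ler_pXn2r _ 2) ?nnegrE //.
rewrite real_normK ?num_real //.
have := ler_pM (sqr_ge0 x) (sqr_ge0 y) xA yB.
have := sqr_ge0 (c * B - d * A).
nra.
Qed.

(** * Distance from a vertex *)

Section Distance.
Variable G : sgraph.
Implicit Types u v w : G.

Lemma distance_eq0 u v : connect (@edge G) u v -> distance u v = 0%N -> v = u.
Proof.
move=> /distance_walk + d0; rewrite d0 => /existsP[p].
by rewrite tuple0 /= => /eqP.
Qed.

Lemma distance_le_diameter u v : (distance u v <= diameter G)%N.
Proof.
apply: leq_trans (leq_bigmax u).
exact: (leq_bigmax (F := distance u) v).
Qed.

(** The last-but-one vertex of a shortest walk is one step nearer. *)
Lemma distance_pred u v k : connected G -> distance u v = k.+1 ->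
  exists2 w, edge w v & distance u w = k.
Proof.
move=> G_conn duv; have := distance_walk (G_conn u v).
rewrite duv => /existsP[[p /= sz_p]].
case/lastP: p sz_p => [//|p z].
rewrite size_rcons eqSS rcons_path last_rcons => /eqP sz_p.
case/andP=> /andP[up ez] /eqP zv; subst z.
exists (last u p) => //; apply/eqP; rewrite eqn_leq -{1}sz_p distance_le //=.
have /existsP[[q /= sz_q] /andP[uq /eqP q_last]] :=
  distance_walk (G_conn u (last u p)).
have := @distance_le G u (rcons q v).
rewrite rcons_path uq q_last ez last_rcons size_rcons duv (eqP sz_q) ltnS.
by apply.
Qed.

Lemma edge_neq u v : edge u v -> u != v.
Proof. by apply: contraTneq => ->; rewrite edge_irrefl. Qed.

Lemma diameter_gt0 u v : connected G -> edge u v -> (0 < diameter G)%N.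
Proof.
move=> G_conn euv; apply: leq_trans (distance_le_diameter u v).
rewrite lt0n; apply: contraTneq euv => d0.
by rewrite (distance_eq0 (G_conn u v) d0) edge_irrefl.
Qed.

End Distance.

(** * Dirichlet energy by distance layers *)

Section Energy.
Variables (R : realFieldType) (G : sgraph) (f : G -> R).
Implicit Types u v w x y : G.

Definition dirichlet : R := \sum_x \sum_(y | edge x y) (f x - f y) ^+ 2.

(** Each edge joining two different distance layers around u is charged to its
    far end, so that disjoint sets of far ends give disjoint sets of edges. *)
Definition inflow u y : R :=
  \sum_(x | edge x y && (distance u x < distance u y)%N) (f x - f y) ^+ 2.

Definition ball_energy u k : R := \sum_(y | (distance u y <= k)%N) inflow u y.

(** dirichlet is halved to count each edge once.  The terms of the edge ab
    add up to 2 (f a)^2 + 2 (f b)^2: the edge ab is replaced by two resistors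
    1/2 that tie a and b to the ground. *)
Definition grounded_energy (a b : G) : R :=
  dirichlet / 2 + (f a + f b) ^+ 2.

Lemma inflow_ge0 u y : 0 <= inflow u y.
Proof. by apply: sumr_ge0 => x _; rewrite sqr_ge0. Qed.

Lemma ball_energy_ge0 u k : 0 <= ball_energy u k.
Proof. by apply: sumr_ge0 => y _; rewrite inflow_ge0. Qed.

Lemma inflow_ge u x y : edge x y -> (distance u x < distance u y)%N ->
  (f x - f y) ^+ 2 <= inflow u y.
Proof.
move=> exy dxy; rewrite /inflow (bigD1 x) ?exy //= lerDl.
by apply: sumr_ge0 => z _; rewrite sqr_ge0.
Qed.

Lemma ball_energyD u k m (s : seq G) : uniq s -> (k <= m)%N ->
    all (fun y => k < distance u y <= m)%N s ->
  ball_energy u k + \sum_(y <- s) inflow u y <= ball_energy u m.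
Proof.
move=> s_uniq km s_km; apply: ler_sum_disjoint => //.
- exact: inflow_ge0.
- by move=> y /= /leq_trans; apply.
- by apply: sub_all s_km => y /=; rewrite -ltnNge.
Qed.

(** The k edges of a shortest path from u to v end in distinct layers, so their
    energies are charged to distinct vertices; each has resistance 1. *)
Lemma sqr_potential_drop_le u v k : connected G -> distance u v = k ->
  (f u - f v) ^+ 2 <= k%:R * ball_energy u k.
Proof.
move=> G_conn; elim: k v => [|k IHk] v duv.
  by rewrite (distance_eq0 (G_conn u v) duv) subrr expr0n mul0r.
have [w ewv duw] := distance_pred G_conn duv.
have := @ball_energyD u k k.+1 [:: v] isT (leqnSn k).
rewrite /= duv ltnS leqnn big_seq1 => /(_ isT) le_ball.
have in_v : (f w - f v) ^+ 2 <= 1 * inflow u v.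
  by rewrite mul1r inflow_ge // duw duv.
have := sqrD_le_mulD (ler0n R k) ler01 (ball_energy_ge0 u k)
  (inflow_ge0 u v) (IHk w duw) in_v.
rewrite addrA subrK natr1 => /le_trans; apply.
by rewrite ler_wpM2l ?ler0n.
Qed.

(** Every edge between layers is counted in both orientations; the last sum
    collects the edges inside a layer. *)
Lemma dirichletE u :
  dirichlet = 2 * \sum_y inflow u y +
    \sum_x \sum_(y | edge x y && (distance u x == distance u y))
      (f x - f y) ^+ 2.
Proof.
rewrite mulr_natl mulr2n -{1}exchange_sum_rel -!big_split.
apply: eq_bigr => x _ /=.
rewrite (bigID (fun y => distance u x < distance u y)%N) /= -addrA.
congr (_ + _); rewrite (bigID (fun y => distance u y < distance u x)%N) /=.
congr (_ + _).
  rewrite /inflow; apply: eq_big => [y|y _]; last exact: sqrBC.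
  by rewrite (edge_sym x y); case: ltngtP; rewrite ?andbF ?andbT.
by apply: eq_bigl => y; case: ltngtP; rewrite ?andbF ?andbT.
Qed.

Lemma dirichlet_ge_inflow u : 2 * \sum_y inflow u y <= dirichlet.
Proof.
rewrite (dirichletE u) lerDl; apply: sumr_ge0 => x _.
by apply: sumr_ge0 => y _; rewrite sqr_ge0.
Qed.

Lemma ball_energy_diameter u :
  ball_energy u (diameter G) = \sum_y inflow u y.
Proof. by apply: eq_bigl => y; rewrite distance_le_diameter. Qed.

Lemma grounded_energyC a b : grounded_energy a b = grounded_energy b a.
Proof. by rewrite /grounded_energy [f a + _]addrC. Qed.

End Energy.

(** * Resistance to the ground *)

Section Potential.
Variables (R : realFieldType) (G : sgraph) (f : G -> R) (a b : G).
Hypotheses (G_conn : connected G) (eab : edge a b).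

Lemma grounded_energy_ge_ends :
  2 * (f a ^+ 2 + f b ^+ 2) <= grounded_energy f a b.
Proof.
have := sum_rel_ge (@edge_sym G) (fun x y => sqrBC (f x) (f y))
  (fun x y => sqr_ge0 _) (edge_neq eab) eab.
rewrite -/(dirichlet f) /grounded_energy; nra.
Qed.

(** The edge ab is charged to b, beyond the layers that a shortest path to a
    meets, so its terms are free to ground a through a resistor 1/2. *)
Lemma sqr_le_grounded_energy_neq (u : G) :
    (distance u a < distance u b)%N ->
  f u ^+ 2 <= ((diameter G)%:R - 1 / 4) * grounded_energy f a b.
Proof.
set k := distance u a => dab.
have bD := distance_le_diameter u b.
have kD : (k < diameter G)%N by apply: leq_trans bD.
have := @ball_energyD R G f u k (diameter G) [:: b] isT (ltnW kD).
rewrite /= dab bD big_seq1 ball_energy_diameter => /(_ isT) le_flow.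
have le_dir := dirichlet_ge_inflow f u.
have in_b := inflow_ge f eab dab.
have path_a := sqr_potential_drop_le f (v := a) G_conn (erefl k).
have ground_a : f a ^+ 2 <= (1 / 2) * (2 * f a ^+ 2) by lra.
have B0 := ball_energy_ge0 f u k.
have a0 : 0 <= 2 * f a ^+ 2 by rewrite mulr_ge0 ?sqr_ge0.
have := sqrD_le_mulD (ler0n R k) (ltac:(lra) : 0 <= 1 / 2 :> R) B0 a0
  path_a ground_a.
rewrite subrK => /le_trans; apply.
have kD' : k%:R + 1 <= (diameter G)%:R :> R by rewrite natr1 ler_nat.
have k0 := ler0n R k.
apply: ler_pM; [lra|lra|lra|].
rewrite /grounded_energy; nra.
Qed.

(** The edge ab lies inside a layer, so that no shortest path from u
    uses it; a and b are then reached by two last edges in parallel. *)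
Lemma sqr_le_grounded_energy_eq (u : G) : distance u a = distance u b ->
  f u ^+ 2 <= ((diameter G)%:R - 1 / 4) * grounded_energy f a b.
Proof.
move=> dab; have ab := edge_neq eab.
case k_eq: (distance u a) => [|j].
  have ua := distance_eq0 (G_conn u a) k_eq.
  have ub := distance_eq0 (G_conn u b) (etrans (esym dab) k_eq).
  by rewrite ua ub eqxx in ab.
have jD : (j < diameter G)%N by rewrite -k_eq distance_le_diameter.
have := @ball_energyD R G f u j (diameter G) [:: a; b].
rewrite /= inE ab -dab k_eq leqnn jD big_cons big_seq1 ball_energy_diameter.
move=> /(_ isT (ltnW jD) isT) le_flow.
have B0 := ball_energy_ge0 f u j.
(* The route to c takes half of what lies within distance j, the other half
   going to the other route, and all of what is specific to c; everything is
   doubled here.  The last edge and the grounding resistor then count as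
   resistances 1 / 2 and 1 / 4. *)
have branch c : distance u c = j.+1 -> f u ^+ 2 <=
    (j%:R + 1 / 2 + 1 / 4) *
    (ball_energy f u j + 2 * inflow f u c + 4 * f c ^+ 2).
  move=> duc; have [w ewc duw] := distance_pred G_conn duc.
  have path_w := sqr_potential_drop_le f G_conn duw.
  have in_c : (f w - f c) ^+ 2 <= inflow f u c.
    by apply: inflow_ge; rewrite ?duw ?duc.
  have in0 := inflow_ge0 f u c.
  have c0 := sqr_ge0 (f c).
  have j0 := ler0n R j.
  have last_w : (f w - f c) ^+ 2 <= (1 / 2) * (2 * inflow f u c) by lra.
  have ground_c : f c ^+ 2 <= (1 / 4) * (4 * f c ^+ 2) by lra.
  have to_c := sqrD_le_mulD (ler0n R j) (ltac:(lra) : 0 <= 1 / 2 :> R) B0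
    (ltac:(lra) : 0 <= 2 * inflow f u c) path_w last_w.
  rewrite addrA subrK in to_c.
  have := sqrD_le_mulD (ltac:(lra) : 0 <= j%:R + 1 / 2 :> R)
    (ltac:(lra) : 0 <= 1 / 4 :> R)
    (ltac:(lra) : 0 <= ball_energy f u j + 2 * inflow f u c)
    (ltac:(lra) : 0 <= 4 * f c ^+ 2) to_c ground_c.
  by rewrite subrK.
have to_a := branch a k_eq.
have to_b := branch b (etrans (esym dab) k_eq).
have level_sym : symmetric
    (fun x y : G => edge x y && (distance u x == distance u y)).
  by move=> x y; rewrite edge_sym eq_sym.
have := sum_rel_ge level_sym (fun x y => sqrBC (f x) (f y))
  (fun x y => sqr_ge0 _) ab.
rewrite eab dab eqxx => /(_ isT) le_level.
have dirE := dirichletE f u.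
have energy_ge : ball_energy f u j + inflow f u a + inflow f u b +
    2 * (f a ^+ 2 + f b ^+ 2) <= grounded_energy f a b.
  by rewrite /grounded_energy; nra.
have j0 := ler0n R j.
have jD' : j%:R + 1 <= (diameter G)%:R :> R by rewrite natr1 ler_nat.
have ina := inflow_ge0 f u a; have inb := inflow_ge0 f u b.
have a2 := sqr_ge0 (f a); have b2 := sqr_ge0 (f b).
apply: (@le_trans _ _ ((j%:R + 1 / 2 + 1 / 4) *
   (ball_energy f u j + inflow f u a + inflow f u b +
    2 * (f a ^+ 2 + f b ^+ 2)))); first by lra.
by apply: ler_pM => //; lra.
Qed.

End Potential.

Lemma sqr_le_grounded_energy (R : realFieldType) (G : sgraph) (f : G -> R)
    (a b u : G) : connected G -> edge a b ->
  f u ^+ 2 <= ((diameter G)%:R - 1 / 4) * grounded_energy f a b.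
Proof.
move=> G_conn eab.
have [ab|ba|ab] := ltngtP (distance u a) (distance u b).
- exact: sqr_le_grounded_energy_neq.
- rewrite grounded_energyC; apply: sqr_le_grounded_energy_neq => //.
  by rewrite edge_sym.
- exact: sqr_le_grounded_energy_eq.
Qed.

Lemma sum_sqr_lt_grounded_energy (R : realFieldType) (G : sgraph)
    (f : G -> R) (a b u : G) :
    connected G -> edge a b -> f u != 0 ->
  \sum_x f x ^+ 2 <
    #|G|%:R * ((diameter G)%:R - 1 / 4) * grounded_energy f a b.
Proof.
move=> G_conn eab fu0.
have D1 : 1 <= (diameter G)%:R :> R by rewrite ler1n (diameter_gt0 G_conn eab).
have le_T x := sqr_le_grounded_energy f x G_conn eab.
have ends := grounded_energy_ge_ends f eab.
have T_gt0 : 0 < grounded_energy f a b.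
  have := le_T u; have : 0 < f u ^+ 2 by rewrite exprn_even_gt0.
  nra.
(* Here (D - 1/4) T >= 3/4 T > T / 2 >= (f a)^2. *)
have lt_a : f a ^+ 2 < ((diameter G)%:R - 1 / 4) * grounded_energy f a b.
  have := sqr_ge0 (f b); have := sqr_ge0 (f a); nra.
rewrite -mulrA mulr_natl -sumr_const (bigD1 a) //= [ltRHS](bigD1 a) //=.
by apply: ltr_leD => //; apply: ler_sum.
Qed.

(** * Eigenfunctions of the Laplacian *)

Lemma laplacian_eigenfunction (R : realType) (K : sgraph) (mu : R) :
    eigenvalue (laplacian K R) mu ->
  exists2 g : K -> R, exists x, g x != 0 &
    forall y, mu * g y = \sum_(x | edge x y) (g y - g x).
Proof.
case/eigenvalueP => v vL /rV0Pn[i vi].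
exists (fun x => v 0 (enum_rank x)).
  by exists (enum_val i); rewrite enum_valK.
move=> y; have /rowP/(_ (enum_rank y)) := vL.
rewrite [RHS]mxE => <-; rewrite mulmxBr mul_mx_diag !mxE enum_rankK.
rewrite sumrB; congr (_ - _).
  rewrite sumr_const mulr_natr /degree cardsE.
  by congr (_ *+ _); apply: eq_card => x; apply: edge_sym.
rewrite [RHS]big_mkcond /= (reindex (@enum_val _ K)) /=; last first.
  by apply: onW_bij; apply: enum_val_bij.
apply: eq_bigr => j _; rewrite !mxE enum_rankK enum_valK.
by case: ifP => _; rewrite ?mulr1 ?mulr0.
Qed.

(** The equation is multiplied by g y so that it also holds at the vertices
    outside H, where g is 0. *)
Lemma subgraph_eigenfunction (R : realType) (G : sgraph) (H : subgraph G)
    (mu : R) : eigenvalue (laplacian H R) mu ->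
  exists2 g : G -> R, exists x, g x != 0 &
    forall y, mu * g y ^+ 2 = \sum_(x | sub_edge H x y) g y * (g y - g x).
Proof.
case/laplacian_eigenfunction => g [x0 gx0] g_eq.
pose g' (z : G) : R := oapp g 0 (insub z).
have g'_val (x : H) : g' (val x) = g x by rewrite /g' valK.
exists g'; first by exists (val x0); rewrite g'_val.
move=> y; have [yH|yH] := boolP (y \in sub_vertex H); last first.
  by rewrite /g' insubN //= expr0n mulr0 big1 // => x _; rewrite mul0r.
have [y' ->] : exists y' : H, y = val y' by exists (Sub y yH); rewrite SubK.
rewrite g'_val expr2 mulrCA g_eq -mulr_sumr; congr (_ * _).
transitivity (\sum_(x in sub_vertex H | sub_edge H x (val y'))
    (g y' - g' x)).
  rewrite big_sub_cond; apply: eq_bigr => x _.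
  by rewrite g'_val.
apply: eq_bigl => x; rewrite andb_idl // => /sub_edge_vertex.
by [].
Qed.

(** * The spectral gap *)

(** If H contained every edge of G, then by connectivity it would contain every
    vertex too: a vertex other than a given one of H has an edge. *)
Lemma proper_subgraph_missing_edge (G : sgraph) (H : subgraph G) :
    connected G -> proper_subgraph H ->
  exists a b : G, edge a b && ~~ sub_edge H a b.
Proof.
move=> G_conn [/card_gt0P[x xH] H_neq].
have [/existsP[a /existsP[b ab]]|/existsPn no_ab] :=
  boolP [exists a : G, exists b : G, edge a b && ~~ sub_edge H a b].
  by exists a, b.
have sub_edgeE : sub_edge H =2 @edge G.
  move=> a b; apply/idP/idP => [/sub_edge_edge //|eab].
  by have /existsPn/(_ b) := no_ab a; rewrite eab negbK.
case: H_neq; split => //; apply/setP => y; rewrite inE.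
have /connectP[[_ /= xy|z p /= /andP[eyz _] _]] := G_conn y x.
  by rewrite -xy.
by apply: (sub_edge_vertex (y := z)); rewrite sub_edgeE.
Qed.

Lemma regular_sum_sqr (R : realFieldType) (G : sgraph) (k : nat)
    (g : G -> R) : regular G k ->
  2 * k%:R * \sum_x g x ^+ 2 =
    \sum_x \sum_(y | edge x y) (g x ^+ 2 + g y ^+ 2).
Proof.
move=> G_reg.
have one_end : \sum_x \sum_(y | edge x y) g x ^+ 2 = k%:R * \sum_x g x ^+ 2.
  rewrite mulr_sumr; apply: eq_bigr => x _; rewrite sumr_const mulr_natl.
  by rewrite -(G_reg x) /degree cardsE.
under [RHS]eq_bigr do rewrite big_split.
rewrite big_split /= one_end.
have -> : \sum_x \sum_(y | edge x y) g y ^+ 2 =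
    \sum_x \sum_(y | edge x y) g x ^+ 2.
  rewrite exchange_sum_rel; apply: eq_bigr => y _.
  by apply: eq_bigl => x; rewrite edge_sym.
rewrite one_end; ring.
Qed.

(** Replacing g by its absolute value lets each edge of H satisfy
    (g x - g y)^2 <= (f x + f y)^2.  In the parallelogram identity summed over
    the edges of G, the terms (f x + f y)^2 of the edges of H thus make up
    for mu, and that of ab remains. *)
Lemma grounded_energy_le (R : realType) (G : sgraph) (Delta : nat)
    (H : subgraph G) (mu : R) (g : G -> R) (a b : G) :
    regular G Delta -> edge a b -> ~~ sub_edge H a b ->
    (forall y, mu * g y ^+ 2 = \sum_(x | sub_edge H x y) g y * (g y - g x)) ->
  grounded_energy (fun x => `|g x|) a b <=
    (2 * Delta%:R - mu) * \sum_x g x ^+ 2.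
Proof.
move=> G_reg eab nHab g_eq.
have muE : 2 * (mu * \sum_x g x ^+ 2) =
    \sum_x \sum_(y | sub_edge H x y) (g x - g y) ^+ 2.
  rewrite mulr_sumr (eq_bigr _ (fun y _ => g_eq y)).
  by rewrite sum_rel_green //; apply: sub_edge_sym.
have DeltaE := regular_sum_sqr g G_reg.
pose plus x y : R := (`|g x| + `|g y|) ^+ 2.
pose out : rel G := fun x y => edge x y && ~~ sub_edge H x y.
have out_sym : symmetric out.
  by move=> x y; rewrite /out edge_sym sub_edge_sym.
have plus_sym x y : plus x y = plus y x by rewrite /plus addrC.
have := sum_rel_ge out_sym plus_sym (fun x y => sqr_ge0 _) (edge_neq eab).
rewrite {1}/out eab nHab => /(_ isT) le_out.
have le_sub : \sum_x \sum_(y | sub_edge H x y) (g x - g y) ^+ 2 <=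
    \sum_x \sum_(y | sub_edge H x y) plus x y.
  apply: ler_sum => x _; apply: ler_sum => y _; rewrite /plus.
  rewrite -real_normK ?num_real // ler_pXn2r ?nnegrE ?addr_ge0 //.
  exact: ler_normB.
have plusE : \sum_x \sum_(y | edge x y) plus x y =
    \sum_x \sum_(y | sub_edge H x y) plus x y +
    \sum_x \sum_(y | out x y) plus x y.
  rewrite -big_split; apply: eq_bigr => x _ /=.
  rewrite (bigID (sub_edge H x)) /=; congr (_ + _); apply: eq_bigl => y.
  by rewrite andb_idl //; apply: sub_edge_edge.
have parallelogram : dirichlet (fun x => `|g x|) +
    \sum_x \sum_(y | edge x y) plus x y =
    2 * \sum_x \sum_(y | edge x y) (g x ^+ 2 + g y ^+ 2).
  rewrite -big_split mulr_sumr; apply: eq_bigr => x _ /=.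
  rewrite -big_split mulr_sumr; apply: eq_bigr => y _ /=.
  rewrite -[g x ^+ 2]real_normK ?num_real // -[g y ^+ 2]real_normK ?num_real //.
  by rewrite /plus; ring.
rewrite /grounded_energy -/(plus a b); nra.
Qed.

Theorem corollary1p3 (R : realType) (G : sgraph) (Delta : nat)
    (H : subgraph G) (G_connected : connected G)
    (G_regular : regular G Delta) (H_proper : proper_subgraph H) :
  2%:R * Delta%:R - laplacian_radius H R >
    1 / (#|G|%:R * ((diameter G)%:R - 1 / 4%:R)) :> R.
Proof.
have H_gt0 : (0 < #|H|)%N by case: H_proper => + _; rewrite card_sig.
have [g [u gu] g_eq] :=
  subgraph_eigenfunction (laplacian_radius_eigenvalue R H_gt0).
have [a [b /andP[eab nHab]]] :=
  proper_subgraph_missing_edge G_connected H_proper.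
have le_gap := grounded_energy_le G_regular eab nHab g_eq.
have := @sum_sqr_lt_grounded_energy R G (fun x => `|g x|) a b u
  G_connected eab.
rewrite normr_eq0 => /(_ gu).
rewrite (eq_bigr (fun x => g x ^+ 2)); last first.
  by move=> x _; rewrite real_normK ?num_real.
set S := \sum_x g x ^+ 2 in le_gap *; set C := #|G|%:R * _ => lt_S.
have S_gt0 : 0 < S.
  rewrite /S (bigD1 u) //= ltr_wpDr ?exprn_even_gt0 //.
  by apply: sumr_ge0 => x _; rewrite sqr_ge0.
have C_gt0 : 0 < C.
  have D1 : 1 <= (diameter G)%:R :> R.
    by rewrite ler1n (diameter_gt0 G_connected eab).
  by apply: mulr_gt0; [rewrite ltr0n; apply/card_gt0P; exists a|lra].
rewrite ltr_pdivrMr // -(ltr_pM2r S_gt0) mul1r.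
apply: lt_le_trans lt_S _.
by rewrite [leRHS]mulrAC [leRHS]mulrC ler_pM2l.
Qed.
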